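(* Let $(X,\tau)$ be a locally compact non-compact Hausdorff space and set $(A,\rho,\mathbb{B})=(RC(X),\rho_X,CR(X))$. Let $C_\rho$ be the relation on $A$ defined by: $aC_\rho b$ iff $a\rho b$ or $a,b\notin\mathbb{B}$. Then $C_\rho$ is the smallest element of the poset $(\mathcal{K}_a(X),\preceq_c)$; hence, if $(\alpha X,\alpha)$ is the Alexandroff (one-point) compactification of $X$, then $\mu_c([(\alpha X,\alpha)])=C_\rho$. Further, the poset $(\mathcal{K}_a(X),\preceq_c)$ has a greatest element $C_{\beta\rho}$; it is defined as follows: for every $a,b\in A$, $a(-C_{\beta\rho})b$ iff there exists a set $\{c_d\in A : d\in\mathbb{D}\}$ such that (1) $a\ll_\rho c_d\ll_\rho b^*$ for all $d\in\mathbb{D}$, and (2) for any two elements $d_1,d_2$ of $\mathbb{D}$, $d_1<d_2$ implies $c_{d_1}\ll_\rho c_{d_2}$. Hence, if $(\beta X,\beta)$ is the Stone–Čech compactification of $X$, then $\mu_c([(\beta X,\beta)])=C_{\beta\rho}$.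
   Context: For a topological space $X$, $RC(X)$ is the complete Boolean algebra of all regular closed subsets ($F=\mathrm{cl}(\mathrm{int}(F))$), with $0=\emptyset$, $1=X$, $F^*=\mathrm{cl}(X\setminus F)$, $F\vee G=F\cup G$, $F\wedge G=\mathrm{cl}(\mathrm{int}(F\cap G))$; $CR(X)$ is the set of compact regular closed subsets; $\rho_X$ is the relation on $RC(X)$ given by $F\rho_XG$ iff $F\cap G\neq\emptyset$. ''$a(-C)b$'' means ''not $aCb$'', and $a\ll_\rho b$ means $a(-\rho)b^*$. $\mathbb{D}$ is the set of all dyadic numbers of the interval $(0,1)$. A normal contact relation on a Boolean algebra $B$ is a binary relation $C$ on $B$ such that: (C1) $a\ne 0$ implies $aCa$; (C2) $aCb$ implies $a\neq 0$ and $b\ne 0$; (C3) $aCb$ implies $bCa$; (C4) $aC(b\vee c)$ iff $aCb$ or $aCc$; (C5) if $a(-C)b$, then there is $c\in B$ with $a(-C)c$ and $b(-C)c^*$; (C6) if $a\neq 1$ then there is $b\neq 0$ with $b(-C)a$. $\mathcal{K}_a(X)$ is the set of all normal contact relations $C$ on $A$ such that $\rho\subseteq C$ and, for every $a\in A$ and $b\in\mathbb{B}$, $aCb$ implies $a\rho b$. It is ordered by $C_1\preceq_cC_2$ iff $C_2\subseteq C_1$. $\mathcal{K}(X)$ is the set of equivalence classes $[(Y,f)]$ of Hausdorff compactifications of $X$ ($Y$ compact Hausdorff, $f:X\to Y$ a dense homeomorphic embedding; $(Y_1,f_1)\sim(Y_2,f_2)$ iff there is a homeomorphism $h:Y_1\to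 Y_2$ with $h\circ f_1=f_2$), ordered by $[(Y_1,f_1)]\le[(Y_2,f_2)]$ iff there is a continuous $h:Y_2\to Y_1$ with $f_1=h\circ f_2$. The map $\mu_c:(\mathcal{K}(X),\le)\to(\mathcal{K}_a(X),\preceq_c)$ is the isomorphism of posets sending $[(Y,f)]$ to the relation $C$ on $RC(X)$ given by $F\,C\,G$ iff $\mathrm{cl}_Y(f(F))\cap\mathrm{cl}_Y(f(G))\neq\emptyset$. *)

(* Defs.v *)
From HB Require Import structures.
From mathcomp Require Import all_boot all_order all_algebra.
From mathcomp Require Import all_classical all_reals topology normedtype.
Set Implicit Arguments.
Unset Strict Implicit.
Unset Printing Implicit Defensive.
Import Order.TTheory GRing.Theory Num.Theory.
Local Open Scope classical_set_scope.

Record RC (X : topologicalType) := MkRC {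
  RC_set :> set X ;
  RC_regclosed : regclosed RC_set
}.

Fact RC_display : Order.disp_t. Proof. exact: Order.Disp tt tt. Qed.

Section RC_boolean_algebra.
Context {X : topologicalType}.
Implicit Types F G H : RC X.

HB.instance Definition _ := gen_eqMixin (RC X).
HB.instance Definition _ := gen_choiceMixin (RC X).

Lemma RC_inj F G : (F : set X) = G -> F = G.
Proof.
case: F G => [F rF] [G rG] /= FG; subst G; congr MkRC; exact: Prop_irrelevance.
Qed.

Lemma RC_closed F : closed F.
Proof. by rewrite -(RC_regclosed F); exact: closed_closure. Qed.

Lemma RC_bot_subproof : regclosed (@set0 X).
Proof. by rewrite /regclosed interior0 closure0. Qed.

Lemma RC_top_subproof : regclosed [set: X].
Proof. by rewrite /regclosed interiorT closureT. Qed.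

Lemma RC_join_subproof F G : regclosed (F `|` G).
Proof.
rewrite /regclosed eqEsubset; split.
  have clFG : closed (F `|` G) by apply: closedU; exact: RC_closed.
  by rewrite [X in _ `<=` X](closure_id _).1//; apply: closureS; exact: interior_subset.
rewrite -[X in X `|` _ `<=` _](RC_regclosed F).
rewrite -[X in _ `|` X `<=` _](RC_regclosed G) -closureU.
apply: closureS; exact: interiorU.
Qed.

Lemma RC_meet_subproof F G : regclosed (closure (F `&` G)°).
Proof. exact/closure_open_regclosed/open_interior. Qed.

Lemma RC_compl_subproof F : regclosed (closure (~` F)).
Proof. exact/closure_open_regclosed/closed_openC/RC_closed. Qed.

Definition RC_le F G : bool := `[< F `<=` G >].
Definition RC_bot : RC X := MkRC RC_bot_subproof.
Definition RC_top : RC X := MkRC RC_top_subproof.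
Definition RC_join F G : RC X := MkRC (RC_join_subproof F G).
Definition RC_meet F G : RC X := MkRC (RC_meet_subproof F G).
Definition RC_compl F : RC X := MkRC (RC_compl_subproof F).

Lemma RC_le_refl : reflexive RC_le.
Proof. by move=> F; exact/asboolP. Qed.

Lemma RC_le_anti : antisymmetric RC_le.
Proof.
by move=> F G /andP[/asboolP FG /asboolP GF]; apply/RC_inj/seteqP.
Qed.

Lemma RC_le_trans : transitive RC_le.
Proof.
by move=> G F H /asboolP FG /asboolP GH; apply/asboolP/(subset_trans FG).
Qed.

HB.instance Definition _ :=
  Order.Le_isPOrder.Build RC_display (RC X) RC_le_refl RC_le_anti RC_le_trans.

Lemma RC_meetP F G H : RC_le F (RC_meet G H) = RC_le F G && RC_le F H.
Proof.
apply/asboolP/andP => [FGH|[/asboolP FG /asboolP FH]].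
  have sub : F `<=` G `&` H.
    apply: (subset_trans FGH) => /=.
    have clGH : closed (G `&` H) by apply: closedI; exact: RC_closed.
    by rewrite [X in _ `<=` X](closure_id _).1//; apply: closureS; exact: interior_subset.
  by split; apply/asboolP => x /sub[].
rewrite -[X in X `<=` _](RC_regclosed F); apply: closureS; apply: interiorS.
by move=> x Fx; split; [exact: FG|exact: FH].
Qed.

Lemma RC_joinP F G H : RC_le (RC_join F G) H = RC_le F H && RC_le G H.
Proof.
apply/asboolP/andP => [FGH|[/asboolP FH /asboolP GH]].
  by split; apply/asboolP => x ?; apply: FGH; [left|right].
by move=> x [/FH|/GH].
Qed.

HB.instance Definition _ := Order.POrder_MeetJoin_isLattice.Build
  RC_display (RC X) RC_meetP RC_joinP.

Lemma RC_meetUl : @left_distributive (RC X) (RC X) RC_meet RC_join.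
Proof.
have meet_sub F G H : F `<=` G -> RC_meet F H `<=` RC_meet G H.
  by move=> FG /=; apply: closureS; apply: interiorS; exact: setSI.
move=> F G H; apply: RC_inj; rewrite eqEsubset; split; last first.
  by move=> x [|]; apply: meet_sub => y ?; [left|right].
rewrite /= -closureU.
suff sub : ((F `|` G) `&` H)° `<=` closure ((F `&` H)° `|` (G `&` H)°).
  move=> x /(closureS sub); rewrite -(closure_id _).1 //.
  exact: closed_closure.
move=> x xU V; rewrite nbhsE => -[V' [oV' V'x] V'V].
pose W := V' `&` ((F `|` G) `&` H)°.
have oW : open W by apply: openI => //; exact: open_interior.
have WFGH : W `<=` (F `|` G) `&` H by move=> y [_ /interior_subset].
have WH : W `<=` H° by rewrite -open_subsetE // => y /WFGH[].
have key (K : RC X) : (K : set X) x ->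
    exists2 y, W y & (K `&` H)° y.
  rewrite -{1}(RC_regclosed K) => /(_ W) [].
    by apply: open_nbhs_nbhs; split.
  by move=> y [Ky Wy]; exists y => //; rewrite interiorI; split => //; exact: WH.
have [[Fx|Gx] _] := WFGH x (conj V'x xU).
  by have [y [? _] ?] := key F Fx; exists y; split; [left|exact: V'V].
by have [y [? _] ?] := key G Gx; exists y; split; [right|exact: V'V].
Qed.

HB.instance Definition _ :=
  Order.Lattice_Meet_isDistrLattice.Build RC_display (RC X) RC_meetUl.

Lemma RC_le0x F : RC_le RC_bot F.
Proof. by apply/asboolP => x []. Qed.

Lemma RC_lex1 F : RC_le F RC_top.
Proof. by apply/asboolP. Qed.

HB.instance Definition _ := Order.hasBottom.Build RC_display (RC X) RC_le0x.
HB.instance Definition _ := Order.hasTop.Build RC_display (RC X) RC_lex1.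

Lemma RC_joinxC F : RC_join F (RC_compl F) = RC_top.
Proof.
apply: RC_inj; rewrite eqEsubset; split => //= x _.
by have [Fx|nFx] := pselect ((F : set X) x); [left|right; exact: subset_closure].
Qed.

Lemma RC_meetxC F : RC_meet F (RC_compl F) = RC_bot.
Proof.
apply: RC_inj => /=.
rewrite interiorI closure_setC interiorC RC_regclosed.
rewrite (_ : _ `&` _ = set0) ?closure0// -subset0 => x [].
by move=> /interior_subset.
Qed.

HB.instance Definition _ := Order.TBDistrLattice_hasComplement.Build
  RC_display (RC X) RC_joinxC RC_meetxC.

End RC_boolean_algebra.

Record normal_contact d (B : ctbDistrLatticeType d) (C : B -> B -> Prop) : Prop
    := NormalContact {
  contactxx : forall a, a <> \bot%O -> C a a ;
  contact_neq0 : forall a b, C a b -> a <> \bot%O /\ b <> \bot%O ;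
  contact_sym : forall a b, C a b -> C b a ;
  contactU : forall a b c, C a (b `|` c)%O <-> C a b \/ C a c ;
  contact_normal : forall a b, ~ C a b ->
    exists c, ~ C a c /\ ~ C b (Order.compl c) ;
  contact_extensional : forall a, a <> \top%O ->
    exists2 b, b <> \bot%O & ~ C b a
}.

Definition strongly_below d (B : ctbDistrLatticeType d) (C : B -> B -> Prop)
    (a b : B) :=
  ~ C a (Order.compl b).

Definition dyadic01 : set rat :=
  [set d : rat | exists k n : nat,
    [/\ (0 < k)%N, (k < 2 ^ n)%N & d = (k%:R / 2 ^+ n)%R]].

Section normal_extensions.
Context {d : Order.disp_t} {A : ctbDistrLatticeType d}.
Variables (rho : A -> A -> Prop) (BB : set A).

Record normal_extension := NormalExtension {
  contact_rel :> A -> A -> Prop ;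
  contact_rel_normal : normal_contact contact_rel ;
  rho_sub_contact : forall a b, rho a b -> contact_rel a b ;
  contact_sub_rho : forall a b, BB b -> contact_rel a b -> rho a b
}.

Definition C_rho (a b : A) : Prop := rho a b \/ ~ BB a /\ ~ BB b.

Definition C_beta_rho (a b : A) : Prop :=
  ~ exists c : dyadic01 -> A,
      (forall t, strongly_below rho a (c t) /\
                 strongly_below rho (c t) (Order.compl b)) /\
      (forall t1 t2, (set_val t1 < set_val t2)%R ->
        strongly_below rho (c t1) (c t2)).

End normal_extensions.

Fact normal_extension_display : Order.disp_t.
Proof. exact: Order.Disp tt tt. Qed.

Section normal_extension_order.
Context {d : Order.disp_t} {A : ctbDistrLatticeType d}.
Context {rho : A -> A -> Prop} {BB : set A}.
Implicit Types C : normal_extension rho BB.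

HB.instance Definition _ := gen_eqMixin (normal_extension rho BB).
HB.instance Definition _ := gen_choiceMixin (normal_extension rho BB).

Lemma normal_extension_inj C1 C2 :
  contact_rel C1 = contact_rel C2 -> C1 = C2.
Proof.
case: C1 C2 => [C1 n1 r1 s1] [C2 n2 r2 s2] /= C12; subst C2.
by congr NormalExtension; exact: Prop_irrelevance.
Qed.

(* The order is reverse inclusion. *)
Definition normal_extension_le C1 C2 : bool :=
  `[< forall a b, C2 a b -> C1 a b >].

Lemma normal_extension_le_refl : reflexive normal_extension_le.
Proof. by move=> C; exact/asboolP. Qed.

Lemma normal_extension_le_anti : antisymmetric normal_extension_le.
Proof.
move=> C1 C2 /andP[/asboolP C12 /asboolP C21]; apply: normal_extension_inj.
by apply/funext => a; apply/funext => b; apply/propext; split=> [/C21|/C12].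
Qed.

Lemma normal_extension_le_trans : transitive normal_extension_le.
Proof.
move=> C1 C2 C3 /asboolP C21 /asboolP C13.
by apply/asboolP => a b /C13 /C21.
Qed.

HB.instance Definition _ := Order.Le_isPOrder.Build normal_extension_display
  (normal_extension rho BB) normal_extension_le_refl normal_extension_le_anti
  normal_extension_le_trans.

End normal_extension_order.

Definition rhoX {X : topologicalType} (F G : RC X) : Prop := F `&` G !=set0.

Definition CR (X : topologicalType) : set (RC X) :=
  [set F : RC X | compact (F : set X)].

Definition Ka (X : topologicalType) := normal_extension (@rhoX X) (@CR X).

Definition homeomorphic_embedding {X Y : topologicalType} (f : X -> Y) :=
  [/\ injective f, continuous f &
      forall U : set X, open U ->
        exists2 V : set Y, open V & f @` U = range f `&` V].

Record compactification (X : topologicalType) := Compactification {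
  cpt_space :> topologicalType ;
  cpt_map : X -> cpt_space ;
  cpt_compact : compact [set: cpt_space] ;
  cpt_hausdorff : hausdorff_space cpt_space ;
  cpt_embedding : homeomorphic_embedding cpt_map ;
  cpt_dense : dense (range cpt_map)
}.
Arguments cpt_map {X} c.

Section compactification_classes.
Context {X : topologicalType}.
Implicit Types c : compactification X.

Definition equivalent_compactifications c1 c2 : Prop :=
  exists h : c1 -> c2, exists g : c2 -> c1,
    [/\ continuous h, continuous g, cancel h g, cancel g h &
        h \o cpt_map c1 = cpt_map c2].

Definition cpt_class c : compactification X -> Prop :=
  equivalent_compactifications c.

Definition cpt_contact c (F G : RC X) : Prop :=
  closure (cpt_map c @` F) `&` closure (cpt_map c @` G) !=set0.

Lemma equivalent_refl c : equivalent_compactifications c c.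
Proof. by exists id, id; split => // x; exact: cvg_id. Qed.

Lemma equivalent_contact c1 c2 F G : equivalent_compactifications c1 c2 ->
  cpt_contact c1 F G -> cpt_contact c2 F G.
Proof.
move=> [h [g [ch _ _ _ hf]]] [y [Fy Gy]]; exists (h y).
have clh (H : RC X) : closure (cpt_map c1 @` H) y ->
    closure (cpt_map c2 @` H) (h y).
  move=> Hy V /ch /Hy [z [[x Hx <-] Vz]]; exists (h (cpt_map c1 x)).
  by split => //; exists x => //; rewrite -hf.
by split; exact: clh.
Qed.

Lemma equivalent_sym c1 c2 : equivalent_compactifications c1 c2 ->
  equivalent_compactifications c2 c1.
Proof.
move=> [h [g [ch cg hK gK hf]]]; exists g, h; split => //.
by rewrite -hf compA (_ : g \o h = id) //; apply/funext.
Qed.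

End compactification_classes.

(* An equivalence class is a predicate rather than a `set`: compactifications
   of X live in a universe above the one allowed by `set`. *)
Record cpt_classes (X : topologicalType) := MkCptClasses {
  cpt_classes_pred :> compactification X -> Prop ;
  cpt_classesP : exists c, cpt_classes_pred = cpt_class c
}.

Definition cpt_class_of {X : topologicalType} (c : compactification X) :
    cpt_classes X :=
  MkCptClasses (ex_intro _ c erefl).

Definition mu_rel {X : topologicalType} (k : cpt_classes X) (F G : RC X) :
    Prop :=
  exists2 c, k c & cpt_contact c F G.

Section cpt_contact_theory.
Context {X : topologicalType} (c : compactification X).
Local Notation f := (cpt_map c).
Implicit Types F G H : RC X.

Lemma cpt_map_continuous : continuous f.
Proof. by have [] := cpt_embedding c. Qed.

Lemma cpt_closure_image (A : set X) x : closed A ->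
  closure (f @` A) (f x) -> A x.
Proof.
move=> clA fAfx; apply: contrapT => nAx.
have [finj _ femb] := cpt_embedding c.
have [V oV fV] := femb _ (closed_openC clA).
have [_ Vfx] : (range f `&` V) (f x) by rewrite -fV; exists x.
have /fAfx [_ [[y Ay <-] Vfy]] : nbhs (f x) V by apply: open_nbhs_nbhs; split.
have : (range f `&` V) (f y) by split => //; exists y.
by rewrite -fV => -[z nAz /finj zy]; apply: nAz; rewrite zy.
Qed.

Lemma cpt_separation (A B : set c) : closed A -> closed B -> A `&` B = set0 ->
  exists V : set c, [/\ open V, B `<=` V & A `&` closure V = set0].
Proof.
move=> clA clB AB0.
have nrm := compact_normal (@cpt_hausdorff _ c) (@cpt_compact _ c).
have [|W BW clWA] := nrm B clB (~` A).
  move=> y By; apply: open_nbhs_nbhs; split; first exact: closed_openC.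
  by move=> Ay; have : (A `&` B) y by []; rewrite AB0.
exists W°; split; first exact: open_interior.
  by move=> y /BW.
rewrite -subset0 => y [Ay Wy]; apply: (clWA y) => //.
by move: y Wy {Ay}; apply: closureS; exact: interior_subset.
Qed.

Lemma cpt_preimage_subproof (V : set c) : open V ->
  regclosed (closure (f @^-1` V)).
Proof.
move=> oV; apply: closure_open_regclosed; apply: open_comp => // x _.
exact: cpt_map_continuous.
Qed.

Definition cpt_preimage (V : set c) (oV : open V) : RC X :=
  MkRC (cpt_preimage_subproof oV).

Lemma closed_cpt_preimage (B : set c) : closed B -> closed (f @^-1` B).
Proof. by move: B; apply/continuous_closedP; exact: cpt_map_continuous. Qed.

Lemma closure_cpt_preimage (V : set c) (oV : open V) :
  closure (f @` cpt_preimage oV) `<=` closure V.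
Proof.
have clV : closed (closure V) by exact: closed_closure.
rewrite [X in _ `<=` X](closure_id _).1//; apply: closureS => _ [x Vx <-].
have : closure (f @^-1` closure V) x.
  by move: x Vx; apply: closureS => x Vx; exact: subset_closure.
by rewrite -(closure_id _).1//; exact: closed_cpt_preimage.
Qed.

Lemma closure_cpt_preimageC (V : set c) (oV : open V) :
  closure (f @` Order.compl (cpt_preimage oV)) `<=` ~` V.
Proof.
have clV : closed (~` V) by exact: open_closedC.
rewrite [X in _ `<=` X](closure_id _).1//; apply: closureS => _ [x nVx <-].
have : closure (f @^-1` (~` V)) x.
  move: x nVx; apply: closureS => x nVx Vfx; apply: nVx.
  exact: subset_closure.
by rewrite -(closure_id _).1//; exact: closed_cpt_preimage.
Qed.

Lemma cpt_contact_normal_contact : normal_contact (cpt_contact c).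
Proof.
split.
- move=> F Fn0; have [[x Fx]|F0] := pselect ((F : set X) !=set0).
    by exists (f x); split; apply: subset_closure; exists x.
  by case: Fn0; apply: RC_inj; apply: contrapT => /eqP/set0P.
- move=> F G [y [Fy Gy]].
  by split=> E; [move: Fy|move: Gy]; rewrite E image_set0 closure0.
- by move=> F G [y [Fy Gy]]; exists y.
- move=> F G H; rewrite /cpt_contact image_setU closureU setIUr.
  split=> [[y [FGy|FHy]]|[[y FGy]|[y FHy]]].
  + by left; exists y.
  + by right; exists y.
  + by exists y; left.
  + by exists y; right.
- move=> F G FG.
  have [|||V [oV GV FV]] := @cpt_separation (closure (f @` F)) (closure (f @` G)).
  + exact: closed_closure.
  + exact: closed_closure.
  + by apply: contrapT => /eqP/set0P.
  exists (cpt_preimage oV); split=> [[y [Fy /closure_cpt_preimage Vy]]|].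
    by have : (closure (f @` F) `&` closure V) y by []; rewrite FV.
  by move=> [y [/GV Vy /closure_cpt_preimageC]].
- move=> F Fn1; have [x nFx] : exists x, ~ (F : set X) x.
    apply: contrapT => /forallNP allF; apply: Fn1; apply: RC_inj.
    by apply/seteqP; split => // x _; apply: contrapT; exact: allF.
  have [|||V [oV GV FV]] := @cpt_separation (closure (f @` F)) [set f x].
  + exact: closed_closure.
  + apply: accessible_closed_set1; apply: hausdorff_accessible.
    exact: cpt_hausdorff.
  + rewrite -subset0 => y [+ yx]; rewrite yx => Ffx; apply: nFx.
    by apply: cpt_closure_image => //; exact: RC_closed.
  exists (cpt_preimage oV).
    move=> /(congr1 (@RC_set X)) /= E; suff : (set0 : set X) x by [].
    by rewrite -E; apply: subset_closure; exact: GV.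
  move=> [y [/closure_cpt_preimage Vy Fy]].
  by have : (closure (f @` F) `&` closure V) y by []; rewrite FV.
Qed.

Lemma rhoX_sub_cpt_contact F G : rhoX F G -> cpt_contact c F G.
Proof.
by move=> [x [Fx Gx]]; exists (f x); split; apply: subset_closure; exists x.
Qed.

Lemma cpt_contact_sub_rhoX F G : CR G -> cpt_contact c F G -> rhoX F G.
Proof.
move=> cG [y [Fy]]; rewrite -(closure_id _).1.
  move=> [x Gx fxy]; exists x; split => //; apply: cpt_closure_image.
    exact: RC_closed.
  by rewrite fxy.
apply: compact_closed; first exact: cpt_hausdorff.
apply: continuous_compact => //; apply: continuous_subspaceT.
exact: cpt_map_continuous.
Qed.

End cpt_contact_theory.

Section mu_c.
Context {X : topologicalType}.
Implicit Types k : cpt_classes X.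

(* The contact relation does not depend on the representative of k. *)
Lemma mu_relE k c : k c -> mu_rel k = cpt_contact c.
Proof.
have [c0 kc0] := cpt_classesP k; rewrite kc0 => c0c; apply/funext => F; apply/funext => G.
apply/propext; split => [[c1]|]; last by exists c => //; rewrite kc0.
rewrite kc0 => c0c1.
move=> /(equivalent_contact (equivalent_sym c0c1)) /(equivalent_contact c0c); exact.
Qed.

Lemma cpt_classes_inhabited k : exists c, k c.
Proof. have [c kc] := cpt_classesP k; exists c; rewrite kc; exact: equivalent_refl. Qed.

Lemma mu_rel_normal k : normal_contact (mu_rel k).
Proof.
have [c /mu_relE ->] := cpt_classes_inhabited k; exact: cpt_contact_normal_contact.
Qed.

Lemma rhoX_sub_mu_rel k F G : rhoX F G -> mu_rel k F G.
Proof.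
have [c /mu_relE ->] := cpt_classes_inhabited k; exact: rhoX_sub_cpt_contact.
Qed.

Lemma mu_rel_sub_rhoX k F G : CR G -> mu_rel k F G -> rhoX F G.
Proof.
have [c /mu_relE ->] := cpt_classes_inhabited k; exact: cpt_contact_sub_rhoX.
Qed.

Definition mu_c k : Ka X :=
  NormalExtension (@mu_rel_normal k) (@rhoX_sub_mu_rel k) (@mu_rel_sub_rhoX k).

End mu_c.

Section alexandroff.
Context {X : topologicalType}.
Hypotheses (lcX : locally_compact [set: X]) (hX : hausdorff_space X).
Hypothesis ncX : ~ compact [set: X].

Lemma Some_homeomorphic_embedding :
  homeomorphic_embedding (Some : X -> one_point_compactification X).
Proof.
split; [by move=> x y []|exact: one_point_compactification_some_continuous|].
move=> U oU; exists (Some @` U).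
  exact: one_point_compactification_open_some.
by apply/esym/setIidr => _ [x _ <-]; exists x.
Qed.

Lemma dense_range_Some :
  dense (range (Some : X -> one_point_compactification X)).
Proof.
move=> U [[x|] Ux oU]; first by exists (Some x); split => //; exists x.
have : nbhs (None : one_point_compactification X) U.
  by apply: open_nbhs_nbhs; split.
move=> [W [cW clW] WU].
have [x nWx] : exists x, ~ W x.
  apply: contrapT => /forallNP allW; apply: ncX.
  rewrite (_ : setT = W) //; apply/seteqP; split => // x _.
  by apply: contrapT; exact: allW.
by exists (Some x); split; [apply: WU; left; exists x|exists x].
Qed.

Definition alexandroff : compactification X :=
  Compactification (@one_point_compactification_compact X)
    (one_point_compactification_hausdorff lcX hX)
    Some_homeomorphic_embedding dense_range_Some.

End alexandroff.

(* The compactification to which every continuous map from X to a compact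
   Hausdorff space extends; this determines it up to equivalence. *)
Definition is_stone_cech {X : topologicalType} (c : compactification X) :=
  forall (Z : topologicalType) (g : X -> Z),
    compact [set: Z] -> hausdorff_space Z -> continuous g ->
    exists2 h : c -> Z, continuous h & h \o cpt_map c = g.

(* A Stone-Cech compactification exists: the closure of the image of X in the
   product of copies of [0, 1] indexed by the continuous maps X -> [0, 1]. *)
Section stone_cech_existence.
Variable R : realType.
Local Open Scope ring_scope.
Import numFieldNormedType.Exports.

Definition unit_fun (T : topologicalType) :=
  [set f : T -> R | continuous f /\ forall x, 0 <= f x <= 1].
Arguments unit_fun : clear implicits.

Definition cube (T : topologicalType) : topologicalType :=
  prod_topology (fun _ : unit_fun T => (R : topologicalType)).

Definition evaluation (T : topologicalType) (x : T) : cube T :=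
  fun phi => set_val phi x.

Lemma cube_continuous (T Y : topologicalType) (h : Y -> cube T) :
  (forall phi, continuous (fun y => h y phi)) -> continuous h.
Proof.
move=> hc y; apply/cvg_sup => phi U [V [[W oW <-] Wh WU]].
apply: filterS WU _; apply: (hc phi y); apply: open_nbhs_nbhs.
by split.
Qed.

Lemma cube_proj_continuous (T : topologicalType) (phi : unit_fun T) :
  continuous (fun p : cube T => p phi).
Proof. exact: (@proj_continuous _ (fun _ => (R : topologicalType)) phi). Qed.

Lemma unit_funP (T : topologicalType) (phi : unit_fun T) :
  continuous (set_val phi) /\ forall x, 0 <= set_val phi x <= 1.
Proof. exact: (set_valP phi). Qed.

Lemma evaluation_continuous (T : topologicalType) : continuous (@evaluation T).
Proof. by apply: cube_continuous => phi; have [] := unit_funP phi. Qed.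

Lemma cube_hausdorff (T : topologicalType) : hausdorff_space (cube T).
Proof. by apply: hausdorff_product => _; exact: Rhausdorff. Qed.

Lemma closure_evaluation_compact (T : topologicalType) :
  compact (closure (range (@evaluation T))).
Proof.
pose Q : set (cube T) := [set p | forall phi, `[0, 1]%classic (p phi)].
have cQ : compact Q.
  apply: (@tychonoff _ (fun _ : unit_fun T => (R : topologicalType))
    (fun=> `[0, 1]%classic)) => _.
  exact: (@segment_compact R).
apply: (subclosed_compact _ cQ _); first exact: closed_closure.
rewrite [X in _ `<=` X](closure_id _).1; last first.
  by apply: compact_closed cQ; exact: cube_hausdorff.
apply: closureS => _ [x _ <-] phi; have [_ /(_ x)] := unit_funP phi.
by rewrite /= in_itv.
Qed.

Definition separated_by_functions (T : topologicalType) :=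
  forall (x : T) (B : set T), closed B -> ~ B x ->
    exists phi : unit_fun T, set_val phi x = 0 /\
      forall y, B y -> set_val phi y = 1.

Lemma completely_regular_separated (T : topologicalType) :
  (forall (x : T) (B : set T), closed B -> ~ B x ->
    uniform_separator [set x] B) ->
  separated_by_functions T.
Proof.
move=> crT x B clB nBx.
have [f [cf f01 fx fB]] := (@uniform_separatorP T R _ _).1 (crT x B clB nBx).
have fP : f \in unit_fun T.
  rewrite inE; split => // y; have : range f (f y) by exists y.
  by move=> /f01; rewrite /= in_itv.
exists (exist _ f fP); split; first by apply: fx; exists x.
by move=> y By; apply: fB; exists y.
Qed.

Lemma evaluation_injective (T : topologicalType) : hausdorff_space T ->
  separated_by_functions T -> injective (@evaluation T).
Proof.
move=> hT sT x y exy; apply: contrapT => nxy.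
have [|//|phi [phix phiy]] := sT x [set y].
  by apply: accessible_closed_set1; exact: hausdorff_accessible.
have := congr1 (fun p : cube T => p phi) exy.
rewrite /evaluation phix phiy// => /eqP.
by rewrite eq_sym oner_eq0.
Qed.

Section construction.
Variable X : topologicalType.
Hypotheses (hX : hausdorff_space X) (sX : separated_by_functions X).

Definition sc_set : set (cube X) := closure (range (@evaluation X)).
Definition sc_space : topologicalType := set_type sc_set.

Lemma sc_map_subproof x : evaluation x \in sc_set.
Proof. by rewrite inE; apply: subset_closure; exists x. Qed.

Definition sc_map (x : X) : sc_space :=
  (@exist _ (fun p => p \in sc_set) _ (sc_map_subproof x) : set_type sc_set).

Lemma set_val_sc_continuous : continuous (set_val : sc_space -> cube X).
Proof. exact: (@initial_continuous sc_space (cube X) set_val). Qed.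

Lemma sc_open (U : set sc_space) :
  open U <-> exists2 V : set (cube X), open V & set_val @^-1` V = U.
Proof. by []. Qed.

Lemma sc_valP (y : sc_space) : sc_set (set_val y).
Proof. exact: set_valP. Qed.

Lemma sc_compact : compact [set: sc_space].
Proof.
move=> F PF FT; have PG : ProperFilter (set_val @ F) by exact: fmap_proper_filter.
have [p [Bp clp]] : sc_set `&` cluster (set_val @ F) !=set0.
  apply: closure_evaluation_compact.
  have : F [set y : sc_space | sc_set (set_val y)].
    by apply: filterS FT => y _; exact: sc_valP.
  by [].
have pB : p \in sc_set by rewrite inE.
exists (@exist _ (fun p => p \in sc_set) _ pB : sc_space); split => // A V FA.
rewrite nbhsE => -[V' [/sc_open[W oW <-] Wp] V'V].
have FsA : (set_val @ F) (set_val @` A).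
  have : F [set y : sc_space | (set_val @` A) (set_val y)].
    by apply: filterS FA => y Ay; exists y.
  by [].
have [_ [[y Ay <-] Wy]] := clp _ W FsA (open_nbhs_nbhs (conj oW Wp)).
by exists y; split => //; exact: V'V.
Qed.

Lemma sc_hausdorff : hausdorff_space sc_space.
Proof.
move=> p q pq; apply: val_inj; apply: (@cube_hausdorff X) => A B pA qB.
have [y [Ay By]] := pq _ _ (set_val_sc_continuous pA)
  (set_val_sc_continuous qB).
by exists (set_val y).
Qed.

Lemma sc_embedding : homeomorphic_embedding sc_map.
Proof.
split.
- move=> x y /(congr1 set_val) /=; exact: evaluation_injective.
- apply/continuousP => U /sc_open[V oV <-].
  by move: V oV; apply/continuousP; exact: evaluation_continuous.
- move=> U oU.
  pose S := [set phi : unit_fun X | forall y, ~ U y -> set_val phi y = 1].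
  pose V : set (cube X) := \bigcup_(phi in S) [set p | p phi < 1].
  have oV : open V.
    apply: bigcup_open => phi _.
    apply: (@open_comp _ _ (fun p : cube X => p phi) [set t : R | t < 1]).
      by move=> p _; exact: cube_proj_continuous.
    exact: open_lt.
  exists (set_val @^-1` V); first by apply/sc_open; exists V.
  rewrite eqEsubset; split=> [_ [x Ux <-]|_ [[x _ <-] [phi Sphi phix]]].
    split; first by exists x.
    have [|phi [phix phi1]] := @sX x (~` U) (open_closedC oU); first by move=> /(_ Ux).
    by exists phi => //=; change (set_val phi x < 1); rewrite phix.
  exists x => //; apply: contrapT => nUx; move: phix => /=.
  by move=> phix; have : set_val phi x < 1 := phix; rewrite Sphi// ltxx.
Qed.

Lemma sc_dense : dense (range sc_map).
Proof.
move=> U [y Uy] /sc_open[V oV VU].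
have Vy : V (set_val y) by move: Uy; rewrite -VU.
have [_ [[x _ <-] Vx]] := @sc_valP y _ (open_nbhs_nbhs (conj oV Vy)).
by exists (sc_map x); split; [rewrite -VU|exists x].
Qed.

Definition sc_compactification : compactification X :=
  Compactification sc_compact sc_hausdorff sc_embedding sc_dense.

Lemma sc_compactification_is_stone_cech : is_stone_cech sc_compactification.
Proof.
move=> Z g cZ hZ gc.
have sZ : separated_by_functions Z.
  apply: completely_regular_separated.
  apply: (@normal_completely_regular R); first exact: compact_normal.
  exact: hausdorff_accessible.
have pull_subproof (phi : unit_fun Z) : (set_val phi \o g) \in unit_fun X.
  have [phic phi01] := unit_funP phi; rewrite inE; split => [x|x]; last exact: phi01.
  by apply: continuous_comp; [exact: gc|exact: phic].
pose pull phi : unit_fun X := @exist _ (fun u => u \in unit_fun X) _ (pull_subproof phi).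
pose P (p : cube X) : cube Z := fun phi => p (pull phi).
have Pc : continuous P.
  by apply: cube_continuous => phi; exact: cube_proj_continuous.
have Pe x : P (evaluation x) = evaluation (g x) by [].
have clE (C : set Z) : closed C -> closed (@evaluation Z @` C).
  move=> clC; apply: compact_closed; first exact: cube_hausdorff.
  apply: continuous_compact.
    by apply: continuous_subspaceT; exact: evaluation_continuous.
  exact: (subclosed_compact clC cZ).
have PB (y : sc_space) : exists z, evaluation z = P (set_val y).
  have [z _ <-] : (@evaluation Z @` setT) (P (set_val y)); last by exists z.
  rewrite [X in X _](closure_id _).1; last exact: clE closedT.
  move=> V /Pc /(@sc_valP y _)[_ [[x _ <-] Vx]].
  by exists (evaluation (g x)); split => //; exists (g x).
have [h hP] := choice PB.
exists h.
  apply/continuous_closedP => C clC.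
  have /continuous_closedP Pvc : continuous (P \o (set_val : sc_space -> cube X)).
    move=> y; apply: continuous_comp; last exact: Pc.
    exact: set_val_sc_continuous.
  rewrite (_ : h @^-1` C = (P \o set_val) @^-1` (@evaluation Z @` C)).
    by apply: Pvc; exact: clE.
  rewrite eqEsubset; split=> y /=; first by move=> Chy; exists (h y).
  by move=> [z Cz]; rewrite -hP => /(evaluation_injective hZ sZ) <-.
apply/funext => x /=; apply: (evaluation_injective hZ sZ).
by rewrite hP.
Qed.

End construction.
Lemma stone_cech_exists (X : topologicalType) :
  locally_compact [set: X] -> hausdorff_space X ->
  exists c : compactification X, is_stone_cech c.
Proof.
move=> lcX hX; have sX : separated_by_functions X.
  apply: completely_regular_separated.
  exact: (@locally_compact_completely_regular X R).
by exists (sc_compactification hX sX); exact: sc_compactification_is_stone_cech.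
Qed.

End stone_cech_existence.

(* Main.v *)
Require Import Defs.
From mathcomp Require Import all_boot all_order all_algebra.
From mathcomp Require Import all_classical all_reals topology normedtype.
From mathcomp Require Import Rstruct.
Set Implicit Arguments.
Unset Strict Implicit.
Unset Printing Implicit Defensive.
Import Order.Theory GRing.Theory Num.Theory.
Local Open Scope classical_set_scope.

(** Both extremal relations are realized by compactifications, which spares the
    verification of the axioms of a normal contact for them.

    The smallest element.  Every contact a C b of a normal extension with a or
    b compact is a contact for rho, so C is contained in C_rho; since the order
    is reverse inclusion, C_rho is smallest as soon as it is a normal extension.
    It is one because it is the contact relation of the Alexandroff
    compactification (alexandroff_contact): two closures meet either at a point
    of X, or at infinity, and the point at infinity is in the closure of a
    closed set exactly when that set is not compact (closure_Some_None).

    The greatest element.  The relation a << b of a normal contact C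
    is transitive and dense, so that a << b can be refined by repeated bisection
    to a chain indexed by the dyadic numbers (dense_dyadic_chain).  When C
    contains rho, a chain for C is also a chain for rho; hence non-contact for C
    implies non-contact for C_beta_rho, that is C_beta_rho is contained in
    every normal extension (C_beta_rho_sub_contact).

    It remains to see that C_beta_rho is itself a normal extension, and again it
    is the contact relation of a compactification, the Stone-Cech one
    (stone_cech_contact).  One inclusion is the bound just described.
    For the other, a dyadic chain between F and the complement of G yields, as
    in the proof of the Urysohn lemma, a continuous function X -> [0, 1]
    which is 0 on F and 1 on G; its continuous extension separates
    the closures of F and G. *)

(** * Dyadic chains in dense transitive relations *)

Section bisection.
Variables (T : Type) (mid : T -> T -> T) (a b : T).

(** The k-th of the 2 ^ n + 1 points of the n-th bisection of the step
    from a to b; it only makes sense for k <= 2 ^ n. *)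
Fixpoint bisect (n k : nat) : T :=
  if n isn't n'.+1 then if k is 0%N then a else b
  else if odd k then mid (bisect n' k./2) (bisect n' k./2.+1)
  else bisect n' k./2.

Lemma bisect0 n : bisect n 0 = a.
Proof. by elim: n. Qed.

Lemma bisect_top n : bisect n (2 ^ n) = b.
Proof. by elim: n => //= n IH; rewrite expnS mul2n odd_double doubleK. Qed.

(** A point keeps its value in all later bisections, so the value depends
    on the fraction k / 2 ^ n alone. *)
Lemma bisect_refine m n k : bisect (n + m) (k * 2 ^ m) = bisect n k.
Proof.
elim: m => [|m IH]; first by rewrite addn0 expn0 muln1.
by rewrite addnS /= expnS mulnCA mul2n odd_double doubleK.
Qed.

Variable lt : T -> T -> Prop.
Hypothesis lt_trans : forall y x z, lt x y -> lt y z -> lt x z.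
Hypothesis lt_mid : forall x y, lt x y -> lt x (mid x y) /\ lt (mid x y) y.
Hypothesis lt_ab : lt a b.

Lemma bisect_step n k : (k < 2 ^ n)%N -> lt (bisect n k) (bisect n k.+1).
Proof.
elim: n k => [|n IH] k; first by case: k.
rewrite expnS mul2n => kn /=.
have /IH /lt_mid[ltl ltr] : (k./2 < 2 ^ n)%N by rewrite ltn_half_double.
by rewrite uphalf_half; case: (odd k) => /=; rewrite ?add1n ?add0n.
Qed.

Lemma bisect_mono n k1 k2 : (k1 < k2)%N -> (k2 <= 2 ^ n)%N ->
  lt (bisect n k1) (bisect n k2).
Proof.
elim: k2 => // k2 IH; rewrite ltnS leq_eqVlt => /orP[/eqP <-|k12] kn.
  exact: bisect_step.
by apply: lt_trans (bisect_step kn); apply: IH => //; exact: ltnW.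
Qed.

End bisection.

(** Choosing midpoints once and for all makes the successive bisections of a
    and b compatible; the element at k / 2 ^ n is the k-th point of the n-th
    one.  The endpoints a and b sit at 0 and 1, which gives the
    outer bounds. *)
Lemma dense_dyadic_chain (T : Type) (lt : T -> T -> Prop) (a b : T) :
  (forall y x z, lt x y -> lt y z -> lt x z) ->
  (forall x z, lt x z -> exists y, lt x y /\ lt y z) ->
  lt a b ->
  exists c : dyadic01 -> T, (forall t, lt a (c t) /\ lt (c t) b) /\
    (forall t1 t2, (set_val t1 < set_val t2)%R -> lt (c t1) (c t2)).
Proof.
move=> ltT ltD ab.
have /choice[mid midP] (p : T * T) :
    exists y, lt p.1 p.2 -> lt p.1 y /\ lt y p.2.
  have [/ltD[y]|nlt] := pselect (lt p.1 p.2); first by exists y.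
  by exists p.1.
have /choice[kn knP] (t : dyadic01) : exists p : nat * nat,
    [/\ (0 < p.1)%N, (p.1 < 2 ^ p.2)%N
      & set_val t = (p.1%:R / 2 ^+ p.2)%R :> rat].
  by have [k [n ?]] := set_valP t; exists (k, n).
pose B := bisect (fun x y => mid (x, y)) a b.
have Bm n k1 k2 : (k1 < k2)%N -> (k2 <= 2 ^ n)%N -> lt (B n k1) (B n k2).
  by apply: bisect_mono => // x y; exact: (midP (x, y)).
exists (fun t => B (kn t).2 (kn t).1); split=> [t|t1 t2].
  have [k0 kn2 _] := knP t; split.
    rewrite -(bisect0 (fun x y => mid (x, y)) a b (kn t).2).
    by apply/Bm/ltnW.
  rewrite -[X in lt _ X](bisect_top (fun x y => mid (x, y)) a b (kn t).2).
  exact: Bm.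
have [_ _ ->] := knP t1; have [_ kn2 ->] := knP t2.
rewrite ltr_pdivrMr ?exprn_gt0// mulrAC ltr_pdivlMr ?exprn_gt0//.
rewrite -!natrX -!natrM ltr_nat => lt12.
(* t1 and t2 come with unrelated denominators 2 ^ n1 and 2 ^ n2: compare them
   in the bisection of level n1 + n2. *)
rewrite /B -[X in lt X _](bisect_refine _ _ _ (kn t2).2).
rewrite -[X in lt _ X](bisect_refine _ _ _ (kn t1).2) [((kn t2).2 + _)%N]addnC.
by apply: Bm => //; rewrite expnD mulnC leq_mul2l (ltnW kn2) orbT.
Qed.

(** * The strong inclusion of a normal contact relation *)

Section normal_contact_theory.
Context {d : Order.disp_t} {B : ctbDistrLatticeType d} (C : B -> B -> Prop).
Hypothesis nC : normal_contact C.

Lemma contactS (a b c : B) : (b <= c)%O -> C a b -> C a c.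
Proof. by move=> /join_idPl <- Cab; apply/(contactU nC); right. Qed.

(** The part of a outside b would be in contact with itself, hence a
    with the complement of b. *)
Lemma strongly_below_le (a b : B) : strongly_below C a b -> (a <= b)%O.
Proof.
move=> ab; suff /eqP : (a `&` ~` b)%O = \bot%O.
  by rewrite disj_leC complK.
apply: contrapT => /(contactxx nC) Cx; apply: ab.
apply: (contactS (leIr _ a)); apply/(contact_sym nC).
by apply: (contactS (leIl _ (~` b)%O)); apply/(contact_sym nC).
Qed.

Lemma strongly_below_trans (b a c : B) :
  strongly_below C a b -> strongly_below C b c -> strongly_below C a c.
Proof.
move=> /strongly_below_le ab bc /(contact_sym nC) /(contactS ab).
by move=> /(contact_sym nC).
Qed.

(** This is the normality axiom, with the complement of its witness. *)
Lemma strongly_below_dense (a c : B) : strongly_below C a c ->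
  exists b, strongly_below C a b /\ strongly_below C b c.
Proof.
move=> /(contact_normal nC)[x [ax cx]]; exists (~` x)%O.
by split; rewrite /strongly_below ?complK// => /(contact_sym nC).
Qed.

(** Non-contact for C_beta_rho asks for a chain for rho; a chain for the larger relation C is
    more than enough, and it exists as soon as a and b are not in contact
    for C. *)
Lemma C_beta_rho_sub_contact (rho : B -> B -> Prop) :
  (forall a b, rho a b -> C a b) -> forall a b, C_beta_rho rho a b -> C a b.
Proof.
move=> rhoC a b; apply: contraPP => nCab; rewrite /C_beta_rho not_notE.
have /(dense_dyadic_chain strongly_below_trans strongly_below_dense) :
  strongly_below C a (~` b)%O by rewrite /strongly_below complK.
have sub x y : strongly_below C x y -> strongly_below rho x y.
  by move=> + /rhoC.
move=> [c [cab cmono]]; exists c; split=> [t|t1 t2 /cmono/sub//].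
by have [/sub ? /sub] := cab t.
Qed.

End normal_contact_theory.

(** * Urysohn functions of dyadic chains *)

Section dyadic_urysohn.
Variable R : realType.
Local Open Scope ring_scope.
Import numFieldNormedType.Exports.

Definition dyadic_val (t : dyadic01) : R := ratr (set_val t).

Lemma dyadic_val_itv t : 0 < dyadic_val t < 1.
Proof.
rewrite /dyadic_val ltr0q -(rmorph1 (@ratr R)) ltr_rat.
have [k [n [k0 kn tE]]] := set_valP t.
rewrite (_ : set_val t = (k%:R / 2 ^+ n : rat))//.
rewrite divr_gt0 ?exprn_gt0 ?ltr0n//=.
by rewrite ltr_pdivrMr ?exprn_gt0// mul1r -natrX ltr_nat.
Qed.

Lemma dyadic_val_dense (x y : R) : 0 <= x -> x < y -> y <= 1 ->
  exists t, x < dyadic_val t < y.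
Proof.
move=> x0 xy y1.
(* The mesh 2 ^- n is less than y - x, and k / 2 ^ n is the first point of the
   mesh beyond x. *)
pose n := Num.bound (y - x)^-1; pose k := (Num.trunc (x * 2 ^+ n)).+1.
have p0 : 0 < 2 ^+ n :> R by rewrite exprn_gt0.
have xk : x < k%:R / 2 ^+ n by rewrite ltr_pdivlMr// truncnS_gt.
have ky : k%:R / 2 ^+ n < y.
  rewrite ltr_pdivrMr// -[y](subrK x) mulrDl /k -natr1 [ltLHS]addrC ltr_leD//.
    rewrite -ltr_pdivrMl ?subr_gt0// mulr1; exact: upper_nthrootP.
  by rewrite truncn_le// mulr_ge0// ltW.
have kn : (k < 2 ^ n)%N.
  rewrite -(ltr_nat R) natrX -[ltRHS]mul1r -ltr_pdivrMr//.
  exact: lt_le_trans y1.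
have kP : (k%:R / 2 ^+ n : rat) \in dyadic01 by rewrite inE; exists k, n.
exists (exist (fun q : rat => q \in dyadic01) _ kP); rewrite /dyadic_val /=.
by rewrite (_ : ratr _ = k%:R / 2 ^+ n) ?xk// fmorph_div rmorphXn /= !ratr_nat.
Qed.

Context {X : topologicalType}.
Variable c : dyadic01 -> set X.
Hypothesis c_closed : forall t, closed (c t).
Hypothesis c_mono : forall t1 t2, set_val t1 < set_val t2 -> c t1 `<=` (c t2)°.

(** The level 1 is always present: it is the value of the infimum where no
    c t contains x. *)
Definition dyadic_levels (x : X) : set R :=
  [set r | r = 1 \/ exists2 t, c t x & r = dyadic_val t].

Definition dyadic_urysohn (x : X) : R := inf (dyadic_levels x).

Local Notation g := dyadic_urysohn.

Lemma dyadic_levels_lbound x : lbound (dyadic_levels x) 0.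
Proof.
by move=> r [->//|[t _ ->]]; have /andP[/ltW] := dyadic_val_itv t.
Qed.

Lemma dyadic_urysohn_le t x : c t x -> g x <= dyadic_val t.
Proof.
move=> ctx; apply: ge_inf; first by exists 0; exact: dyadic_levels_lbound.
by right; exists t.
Qed.

Lemma dyadic_urysohn_itv x : 0 <= g x <= 1.
Proof.
apply/andP; split.
  by apply: lb_le_inf; [exists 1; left|exact: dyadic_levels_lbound].
by apply: ge_inf; [exists 0; exact: dyadic_levels_lbound|left].
Qed.

Lemma dyadic_urysohn_ge t x : ~ c t x -> dyadic_val t <= g x.
Proof.
move=> nctx; apply: lb_le_inf; first by exists 1; left.
move=> r [->|[s csx ->]]; first by have /andP[_ /ltW] := dyadic_val_itv t.
rewrite leNgt ltr_rat; apply/negP => /c_mono /(_ _ csx) /interior_subset.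
exact: nctx.
Qed.

(** Upper bounds of g near x persist on the interior of some c u, lower
    bounds on the complement of some c u, which is open. *)
Lemma dyadic_urysohn_continuous : continuous g.
Proof.
move=> x; apply/cvgrPdist_lt => e e0.
have /andP[g0 g1] := dyadic_urysohn_itv x.
have up : \forall y \near x, g y < g x + e.
  have [|ge1] := ltP 1 (g x + e).
    move=> ge1; near=> y; apply: le_lt_trans ge1.
    by have /andP[] := dyadic_urysohn_itv y.
  have [||_ [->|[t ctx ->]] te] := @inf_lt R (dyadic_levels x) (g x + e).
  - by exists 1; left.
  - by rewrite ltrDl.
  - by move: te; rewrite ltNge ge1.
  have /andP[/ltW t0 _] := dyadic_val_itv t.
  have [u /andP[tu ue]] := dyadic_val_dense t0 te ge1.
  have : \forall y \near x, c u y.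
    by apply: (@c_mono t u) ctx; move: tu; rewrite ltr_rat.
  by apply: filterS => y /dyadic_urysohn_le gu; exact: le_lt_trans ue.
have lo : \forall y \near x, g x - e < g y.
  have [ge0|] := ltP (g x - e) 0.
    near=> y; apply: (lt_le_trans ge0).
    by have /andP[] := dyadic_urysohn_itv y.
  move=> ge0; have [|u /andP[eu ug]] := dyadic_val_dense ge0 _ g1.
    by rewrite ltrBlDr ltrDl.
  have : \forall y \near x, (~` c u) y.
    apply: open_nbhs_nbhs; split; first exact: closed_openC.
    by move=> /dyadic_urysohn_le; rewrite leNgt ug.
  by apply: filterS => y /dyadic_urysohn_ge gu; exact: lt_le_trans eu _.
near=> y; rewrite ltr_distlC; apply/andP; split; near: y; exact.
Unshelve. all: by end_near.
Qed.

Lemma dyadic_urysohn0 x : (forall t, c t x) -> g x = 0.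
Proof.
move=> cx; have /andP[g0 g1] := dyadic_urysohn_itv x.
apply/eqP; rewrite eq_le g0 andbT leNgt; apply/negP => gx0.
have [t /andP[_ /lt_geF]] := dyadic_val_dense (lexx 0) gx0 g1.
by rewrite dyadic_urysohn_le.
Qed.

Lemma dyadic_urysohn1 x : (forall t, ~ c t x) -> g x = 1.
Proof.
move=> ncx; have /andP[g0 g1] := dyadic_urysohn_itv x.
apply/eqP; rewrite eq_le g1 /= leNgt; apply/negP => gx1.
have [t /andP[/lt_geF + _]] := dyadic_val_dense g0 gx1 (lexx 1).
by rewrite dyadic_urysohn_ge.
Qed.

End dyadic_urysohn.

(** * The contact relation of the Stone-Cech compactification *)

Section stone_cech_contact.
Import numFieldNormedType.Exports.
Context {X : topologicalType}.

(** The target of the universal property must be compact, which R is not: extend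
    the canonical map to the closure of X in the cube, which has phi among its
    coordinates, and project. *)
Lemma stone_cech_extend (R : realType) (c : compactification X) :
  is_stone_cech c -> forall phi : @unit_fun R X,
  exists2 h : c -> R, continuous h & h \o cpt_map c = set_val phi.
Proof.
move=> scc phi.
have sc_map_continuous : continuous (@sc_map R X).
  apply/continuousP => U /sc_open[V oV <-].
  by move: V oV; apply/continuousP; exact: evaluation_continuous.
have [h hc hE] := scc _ (@sc_map R X) (@sc_compact R X) (@sc_hausdorff R X)
  sc_map_continuous.
exists (fun y => set_val (h y) phi).
  move=> y.
  apply: (@continuous_comp _ _ _ h (fun z : sc_space R X => set_val z phi)).
    exact: hc.
  apply: (@continuous_comp _ _ _ (set_val : sc_space R X -> cube R X)
    (fun p => p phi)).
    exact: set_val_sc_continuous.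
  exact: cube_proj_continuous.
by apply/funext => x /=; rewrite -[h _]/((h \o cpt_map c) x) hE.
Qed.

Lemma strongly_below_rhoX (F G : RC X) :
  strongly_below (@rhoX X) F G -> F `<=` (G : set X)°.
Proof.
move=> FG x Fx; apply: contrapT => nGx; apply: FG; exists x; split => //.
by rewrite /= closure_setC.
Qed.

(** The extension to c of the Urysohn function of a chain would take both
    values 0 and 1 at a common point of the closures of F and G. *)
Lemma stone_cech_sub_C_beta_rho (R : realType) (c : compactification X)
    (F G : RC X) :
  is_stone_cech c -> cpt_contact c F G -> C_beta_rho (@rhoX X) F G.
Proof.
move=> scc [y [Fy Gy]] [K [FKG Kmono]].
have KS t1 t2 : (set_val t1 < set_val t2)%R -> K t1 `<=` (K t2 : set X)°.
  by move=> /Kmono/strongly_below_rhoX.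
pose g := dyadic_urysohn R (fun t => K t : set X).
have gP : g \in @unit_fun R X.
  rewrite inE; split; last exact: dyadic_urysohn_itv.
  by apply: dyadic_urysohn_continuous => // t; exact: RC_closed.
have [h hc hE] := stone_cech_extend scc
  (exist (fun u => u \in @unit_fun R X) g gP).
have hcst (r : R) (H : RC X) : (forall x, (H : set X) x -> g x = r) ->
    closure (cpt_map c @` H) y -> h y = r.
  move=> gr Hy; suff : (h @^-1` [set r]) y by [].
  have hr : closed (h @^-1` [set r]).
    by apply: closed_comp => [z _|]; [exact: hc|exact: closed_eq].
  rewrite [X in X y](closure_id _).1//; move: y Hy {Fy Gy}; apply: closureS.
  by move=> _ [x Hx <-]; rewrite /= -[h _]/((h \o cpt_map c) x) hE; exact: gr.
have h0 : h y = 0%R.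
  apply: hcst Fy => x Fx; apply: dyadic_urysohn0 => t.
  by apply: interior_subset; apply: strongly_below_rhoX Fx; have [] := FKG t.
have : h y = 1%R.
  apply: hcst Gy => x Gx; apply: dyadic_urysohn1 => // t Kx.
  have [_] := FKG t; rewrite /strongly_below complK; apply.
  by exists x.
by rewrite h0 => /eqP; rewrite eq_sym oner_eq0.
Qed.

Lemma stone_cech_contact (R : realType) (c : compactification X) :
  is_stone_cech c -> cpt_contact c = C_beta_rho (@rhoX X).
Proof.
move=> scc; apply/funext => F; apply/funext => G; apply/propext; split.
  exact: (stone_cech_sub_C_beta_rho R scc).
apply: C_beta_rho_sub_contact; first exact: cpt_contact_normal_contact.
exact: rhoX_sub_cpt_contact.
Qed.

End stone_cech_contact.

(** * The contact relation of the Alexandroff compactification *)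

Section alexandroff_contact.
Context {X : topologicalType}.
Hypotheses (lcX : locally_compact [set: X]) (hX : hausdorff_space X).
Hypothesis ncX : ~ compact [set: X].

(** The complements of compact closed sets are a base of punctured
    neighbourhoods of infinity, so infinity is away from F exactly when a
    compact set contains F. *)
Lemma closure_Some_None (F : set X) : closed F ->
  closure (Some @` F : set (one_point_compactification X)) None <-> ~ compact F.
Proof.
move=> clF; split=> [Fcl cF|ncF U [W [cW clW] WU]].
  have /Fcl[_ [[x Fx <-] []]] :
      nbhs (None : one_point_compactification X)
        (Some @` (~` F) `|` [set None]) by exists F.
    by move=> [z nFz [zx]]; apply: nFz; rewrite zx.
  by [].
have [x Fx nWx] : exists2 x, F x & ~ W x.
  apply: contrapT => /forall2NP FW; apply: ncF.
  by apply: subclosed_compact clF cW _ => x Fx; case: (FW x) => // /contrapT.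
by exists (Some x); split; [exists x|apply: WU; left; exists x].
Qed.

Lemma alexandroff_contact :
  cpt_contact (alexandroff lcX hX ncX) = C_rho (@rhoX X) (@CR X).
Proof.
apply/funext => F; apply/funext => G; apply/propext.
have cln (H : RC X) := closure_Some_None (@RC_closed X H).
split=> [[[x|] [Fy Gy]]|[FG|[nF nG]]].
- left; exists x; split.
    by apply: (@cpt_closure_image _ (alexandroff lcX hX ncX)) Fy; exact: RC_closed.
  by apply: (@cpt_closure_image _ (alexandroff lcX hX ncX)) Gy; exact: RC_closed.
- by right; split; apply/cln.
- exact: rhoX_sub_cpt_contact.
- by exists None; split; apply/cln.
Qed.

End alexandroff_contact.

(** * The smallest and the greatest normal extension *)

Lemma normal_extension_sub_C_rho d (A : ctbDistrLatticeType d)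
    (rho : A -> A -> Prop) (BB : set A) (C : normal_extension rho BB) (a b : A) :
  (forall x y, rho x y -> rho y x) -> C a b -> C_rho rho BB a b.
Proof.
move=> rho_sym Cab.
have [Bb|nBb] := pselect (BB b); first by left; exact: contact_sub_rho Cab.
have [Ba|nBa] := pselect (BB a); last by right.
left; apply: rho_sym; apply: (contact_sub_rho Ba).
exact: (contact_sym (contact_rel_normal C)).
Qed.

Theorem proposition2p12 (X : topologicalType)
    (lcX : locally_compact [set: X]) (hX : hausdorff_space X)
    (ncX : ~ compact [set: X]) :
  (exists Cmin : Ka X,
    [/\ contact_rel Cmin = C_rho (@rhoX X) (@CR X),
        (forall C : Ka X, (Cmin <= C)%O) &
        mu_c (cpt_class_of (alexandroff lcX hX ncX)) = Cmin]) /\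
  (exists Cmax : Ka X,
    [/\ contact_rel Cmax = C_beta_rho (@rhoX X),
        (forall C : Ka X, (C <= Cmax)%O) &
        forall bX : compactification X, is_stone_cech bX ->
          mu_c (cpt_class_of bX) = Cmax]).
Proof.
have muE (c : compactification X) :
    contact_rel (mu_c (cpt_class_of c)) = cpt_contact c.
  by apply: mu_relE; exact: equivalent_refl.
split.
  exists (mu_c (cpt_class_of (alexandroff lcX hX ncX))).
  split=> // [|C]; first by rewrite muE alexandroff_contact.
  apply/asboolP => F G CFG; rewrite muE alexandroff_contact.
  apply: (normal_extension_sub_C_rho _ CFG) => K L [x [Kx Lx]].
  by exists x.
have [c0 sc0] := stone_cech_exists Rdefinitions.R lcX hX.
have scE c := stone_cech_contact Rdefinitions.R (c := c).
exists (mu_c (cpt_class_of c0)).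
split=> [|C|c scc]; first by rewrite muE scE.
  apply/asboolP => F G; rewrite muE scE//.
  apply: C_beta_rho_sub_contact; first exact: contact_rel_normal.
  exact: rho_sub_contact.
by apply: normal_extension_inj; rewrite !muE !scE.
Qed.
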